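(* (a) $\mathsf{LO}_l$, $\mathsf{LO}_r$ and $\mathsf{LO}_r\cap\mathsf{LO}_l$ are $\mathbf{\Sigma}^1_1$-complete. (b) $\mathsf{LO}\setminus(\mathsf{LO}_r\cup\mathsf{LO}_l)$ is $\mathbf{\Pi}^1_1$-complete. (c) $\mathsf{LO}_r\setminus\mathsf{LO}_l$ and $\mathsf{LO}_l\setminus\mathsf{LO}_r$ are $D_2(\mathbf{\Pi}^1_1)$-complete.
   Context: $\mathsf{LO}$ is the Polish space of codes $L\in 2^{\mathbb{N}\times\mathbb{N}}$ for reflexive linear orders on $\mathbb{N}$. A linear order $L$ is right compressible if $L=L'+L_r$ with $L'\cong L$ and $L_r\ne\emptyset$, and left compressible if $L=L_l+L'$ with $L'\cong L$ and $L_l\neq\emptyset$; $\mathsf{LO}_r,\mathsf{LO}_l\subseteq\mathsf{LO}$ are the sets of right, respectively left, compressible codes. $D_2(\mathbf{\Pi}^1_1)$ is the class of sets that are the intersection of an analytic and a coanalytic set. For a class $\Gamma$ and a subset $A$ of a Polish space $Y$, $A$ is $\Gamma$-hard if every $B\in\Gamma(X)$ with $X$ zero-dimensional Polish is Wadge reducible to $A$ (i.e. $B=\varphi^{-1}(A)$ for some continuous $\varphi\colon X\to Y$), and $\Gamma$-complete if moreover $A\in\Gamma(Y)$. *)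

(* Defs.v *)
From HB Require Import structures.
From mathcomp Require Import all_boot all_order all_algebra.
From mathcomp Require Import mathcomp_extra boolp classical_sets functions.
From mathcomp Require Import cardinality reals topology.

Set Implicit Arguments.
Unset Strict Implicit.
Unset Printing Implicit Defensive.

Local Open Scope classical_set_scope.

Definition separable (X : topologicalType) : Prop :=
  exists2 D : set X, countable D & dense D.

Definition homeomorphic (X Y : topologicalType) : Prop :=
  exists (f : X -> Y) (g : Y -> X),
    [/\ cancel f g, cancel g f, continuous f & continuous g].

(* [completeType] is not used here because it forces the space to be pointed,
   which would rule out the empty Polish space (hence the empty analytic
   set). *)
Definition cauchy_complete (M : uniformType) : Prop :=
  forall F : set_system M, ProperFilter F -> cauchy F -> exists x : M, F --> x.

Definition polish_space (R : realType) (X : topologicalType) : Prop :=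
  separable X /\
  exists2 M : metricType R, cauchy_complete M & homeomorphic X M.

(* The library's [zero_dimensional] only asks that distinct points be separated
   by a clopen set; this is strictly weaker, even for Polish spaces (complete
   Erdos space). *)
Definition has_clopen_basis (X : topologicalType) : Prop :=
  basis (@clopen X).

Definition pointclass := forall X : topologicalType, set (set X).

Definition Sigma11 (R : realType) : pointclass := fun X A =>
  exists (Y : topologicalType) (f : Y -> X),
    [/\ polish_space R Y, continuous f & A = range f].

Definition Pi11 (R : realType) : pointclass := fun X A =>
  Sigma11 R (~` A).

Definition D2Pi11 (R : realType) : pointclass := fun X A =>
  exists B C : set X, [/\ Sigma11 R B, Pi11 R C & A = B `&` C].

Definition wadge_reducible (X Y : topologicalType) (B : set X) (A : set Y)
    : Prop :=
  exists2 phi : X -> Y, continuous phi & B = phi @^-1` A.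

Definition class_hard (R : realType) (G : pointclass) (Y : topologicalType)
    (A : set Y) : Prop :=
  forall X : topologicalType, polish_space R X -> has_clopen_basis X ->
    forall B : set X, G X B -> wadge_reducible B A.

Definition class_complete (R : realType) (G : pointclass) (Y : topologicalType)
    (A : set Y) : Prop :=
  G Y A /\ class_hard R G A.

Definition code : Type := prod_topology (fun _ : nat * nat => bool).

HB.instance Definition _ := Topological.on code.

Definition code_rel (L : code) : rel nat := fun x y => L (x, y).

Definition linear_order (r : rel nat) : Prop :=
  [/\ reflexive r, antisymmetric r, transitive r & total r].

(* Coerced to a type, [LO] carries the subspace topology of [code]. *)
Definition LO : set code := [set L | linear_order (code_rel L)].

Definition is_sum (r : rel nat) (A B : set nat) : Prop :=
  [/\ A `|` B = setT, A `&` B = set0 & forall x y, A x -> B y -> r x y].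

Definition suborder_iso (r : rel nat) (A B : set nat) : Prop :=
  exists2 f : nat -> nat, set_bij A B f & {in A &, {mono f : x y / r x y}}.

Definition right_compressible (r : rel nat) : Prop :=
  exists A B : set nat,
    [/\ is_sum r A B, suborder_iso r A setT & B !=set0].

Definition left_compressible (r : rel nat) : Prop :=
  exists A B : set nat,
    [/\ is_sum r A B, suborder_iso r B setT & A !=set0].

Definition LO_r : set LO :=
  [set L | right_compressible (code_rel (set_val L))].

Definition LO_l : set LO :=
  [set L | left_compressible (code_rel (set_val L))].

(* Main.v *)
(* For a tree T on the naturals, order the finite sequences of nodes of T that
   descend in the Kleene-Brouwer order KB(T) lexicographically: this is the
   exponential 2^KB(T).  Let A(T) be this order times omega, and let
   F(S, T) = A(S)^* + Q + A(T).
   - If T has no branch, A(T) is a well-order.  The copy of Q is definable (its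
     points are the two-sided limits), so an isomorphism of F(S, T) with an
     initial segment maps A(T) into itself; there it is increasing, hence
     inflationary, so the initial segment is everything.
   - If T has a branch, let R be the non-accessible part of KB(T); it is a final
     segment without minimum.  For x in R the orders 2^R and 2^(R below x) are
     both countable dense with a minimum and no maximum, so they are isomorphic
     by back and forth, and A(T) is isomorphic to the proper initial segment of
     sequences below x.
   So F(S, T) is right compressible iff T has a branch and, by reversal, left
   compressible iff S has one, independently of each other.  As an analytic
   subset of a zero-dimensional Polish space is the set of x such that T_x has a
   branch, for trees T_x depending continuously on x, all six hardness claims
   follow from this single reduction. *)
Require Import Defs.
From HB Require Import structures.
From mathcomp Require Import all_boot all_order all_algebra.
From mathcomp Require Import mathcomp_extra boolp classical_sets functions.
From mathcomp Require Import cardinality reals topology.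

Set Implicit Arguments.
Unset Strict Implicit.
Unset Printing Implicit Defensive.
Import Order.TTheory GRing.Theory Num.Theory.

Local Open Scope classical_set_scope.

(** * Polish subspaces of the Baire space *)

(** [LO] carries the initial topology of the coordinates, so local constancy of each bit of the code
    suffices. *)
Lemma continuous_LO (X : topologicalType) (phi : X -> LO) :
  (forall x p, \forall x' \near x, set_val (phi x') p = set_val (phi x) p) ->
  continuous phi.
Proof.
move=> phiP; apply: continuous_comp_initial => x.
apply/cvg_sup => p; apply/cvg_image.
  apply/seteqP; split=> // b _; exists (fun=> b) => //.
move=> U /= Ub; exists [set y : code | U (y p)].
  apply: filterS (phiP x p) => y /= ->; exact: nbhs_singleton.
apply/seteqP; split=> [b [y Uy <-]//|b bU].
by exists (fun=> b).
Qed.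

(* [R] only serves as the value field of the metric defined below. *)
Definition baire_sub (R : realType) (Phi : set (nat -> nat)) : Type :=
  {u : nat -> nat | Phi u}.

Section BaireMetric.
Variables (R : realType) (Phi : set (nat -> nat)).
Local Notation M := (baire_sub R Phi).
Local Open Scope ring_scope.

Definition agree (n : nat) (u v : nat -> nat) := forall i, (i < n)%N -> u i = v i.

HB.instance Definition _ := gen_eqMixin M.
HB.instance Definition _ := gen_choiceMixin M.

Definition baire_dist (x y : M) : R :=
  if pselect (exists n, sval x n != sval y n) is left h
  then (ex_minn h).+1%:R^-1 else 0.

Lemma baire_dist_ge (x y : M) n :
  sval x n <> sval y n -> n.+1%:R^-1 <= baire_dist x y.
Proof.
move=> /eqP xy; rewrite /baire_dist; case: pselect => [h|[]]; last by exists n.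
case: ex_minnP => m _ /(_ _ xy) mn.
by rewrite lef_pV2 ?posrE ?ltr0n// ler_nat.
Qed.

Lemma baire_dist_lt (x y : M) n :
  baire_dist x y < n.+1%:R^-1 <-> agree n.+1 (sval x) (sval y).
Proof.
split=> [xy i i_n|xy].
  apply: contrapT => /baire_dist_ge; apply/negP; rewrite -ltNge.
  apply: lt_le_trans xy _.
  by rewrite lef_pV2 ?posrE ?ltr0n// ler_nat.
rewrite /baire_dist; case: pselect => [h|_]; last by rewrite invr_gt0 ltr0n.
case: ex_minnP => m /eqP xym _; have [/xy//|nm] := ltnP m n.+1.
by rewrite ltf_pV2 ?posrE ?ltr0n// ltr_nat.
Qed.

Lemma baire_distxx x : baire_dist x x = 0.
Proof.
by rewrite /baire_dist; case: pselect => // h; exfalso; case: h => n; rewrite eqxx.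
Qed.

Lemma baire_dist_ge0 x y : 0 <= baire_dist x y.
Proof. by rewrite /baire_dist; case: pselect => // h; rewrite invr_ge0 ler0n. Qed.

Lemma baire_dist_eq0 x y : baire_dist x y = 0 -> x = y.
Proof.
case: x y => [u Pu] [v Pv] xy0; apply: eq_exist; apply/funext => n.
have /baire_dist_lt : baire_dist (exist _ u Pu) (exist _ v Pv) < n.+1%:R^-1.
  by rewrite xy0 invr_gt0 ltr0n.
exact.
Qed.

Lemma baire_dist_sym x y : baire_dist x y = baire_dist y x.
Proof.
rewrite /baire_dist; case: pselect => [h|h]; case: pselect => [h'|h'] //.
- case: ex_minnP => m xm mmin; case: ex_minnP => k yk kmin.
  congr (_.+1%:R^-1); apply/eqP; rewrite eqn_leq mmin ?kmin// eq_sym//.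
- by case: h' ; case: h => n; exists n; rewrite eq_sym.
- by case: h; case: h' => n; exists n; rewrite eq_sym.
Qed.

Lemma baire_dist_triangle y x z :
  baire_dist x z <= baire_dist x y + baire_dist y z.
Proof.
rewrite {1}/baire_dist; case: pselect => [h|_]; last first.
  by rewrite addr_ge0// baire_dist_ge0.
case: ex_minnP => m /eqP xz _.
have [xy|xy] := eqVneq (sval x m) (sval y m).
  rewrite (le_trans (@baire_dist_ge y z m _)) ?lerDr ?baire_dist_ge0//.
  by rewrite -xy.
by rewrite (le_trans (@baire_dist_ge x y m _)) ?lerDl ?baire_dist_ge0//; apply/eqP.
Qed.

HB.instance Definition _ := isMetric.Build R M
  baire_distxx baire_dist_eq0 baire_dist_sym baire_dist_triangle.

(** Closedness in the Baire space, stated through finite prefixes so that it can be checked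
    combinatorially. *)
Definition baire_closed :=
  forall u, (forall n, exists2 v, Phi v & agree n u v) -> Phi u.

Lemma agree_nbhs (x : M) n : \forall y \near x, agree n (sval x) (sval y).
Proof.
apply/nbhs_ballP; exists n.+1%:R^-1 => /=; first by rewrite invr_gt0 ltr0n.
by move=> y /=; rewrite ballEmdist /= => /baire_dist_lt xy i /ltnW/xy.
Qed.

Lemma baire_cauchy_complete : baire_closed -> cauchy_complete M.
Proof.
move=> Phicl F FF /cauchyP Fc.
have /choice[x xP] : forall n, exists x : M, F [set y | agree n.+1 (sval x) (sval y)].
  move=> n; have [|x xF] := Fc n.+1%:R^-1; first by rewrite invr_gt0 ltr0n.
  by exists x; apply: filterS xF => y; rewrite ballEmdist /= => /baire_dist_lt.
(* Diagonal limit: [F]-almost every point agrees with [x n] up to and including index [n], so the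
   values picked at different stages are coherent. *)
pose u n := sval (x n) n.
have xu n : agree n.+1 u (sval (x n)).
  move=> i i_n.
  have [y [yn yi]] := filter_ex (filterI (xP n) (xP i)).
  by rewrite /u yi// yn.
have Phiu : Phi u.
  apply: Phicl => n; exists (sval (x n)); first exact: svalP.
  by move=> i /ltnW/xu.
exists (exist _ u Phiu : M) => U /nbhs_ballP[e /= e0 eU].
have [n ne] : exists n, n.+1%:R^-1 < e.
  exists (Num.truncn e^-1); rewrite invf_plt ?posrE ?ltr0n//.
  by rewrite truncnS_gt.
apply: filterS (xP n) => y xy; apply: eU; rewrite ballEmdist /=.
apply: lt_trans ne; apply/baire_dist_lt => i i_n /=.
by rewrite (xu n)// xy.
Qed.

Lemma baire_separable : separable M.
Proof.
have [[u0 Pu0]|no] := pselect (exists u, Phi u); last first.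
  exists set0; first exact: countable0.
  by move=> O [x _]; case: no; exists (sval x); exact: svalP.
pose x0 : M := exist _ u0 Pu0.
(* One member of [Phi] per finite prefix; prefixes without an extension in [Phi] fall back on
   [x0]. *)
pose f (s : seq nat) := xget x0 [set y : M | agree (size s) (nth 0%N s) (sval y)].
exists (range f); first exact: card_le_trans (card_image_le _ _) (countableP _).
move=> O [x Ox] Oo.
have /nbhs_ballP[e /= e0 eO] : nbhs x O by exact: open_nbhs_nbhs.
have [n ne] : exists n, n.+1%:R^-1 < e.
  exists (Num.truncn e^-1); rewrite invf_plt ?posrE ?ltr0n//.
  by rewrite truncnS_gt.
exists (f (mkseq (sval x) n.+1)); split; last by eexists.
apply: eO; rewrite ballEmdist /=; apply: lt_trans ne.
apply/baire_dist_lt => i i_n; rewrite /f.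
case: xgetP => [y _ /(_ i)|/(_ x)[]].
  by rewrite size_mkseq => /(_ i_n) <-; rewrite nth_mkseq.
by move=> j; rewrite size_mkseq => jn; rewrite nth_mkseq.
Qed.

Lemma baire_sub_polish : baire_closed -> polish_space R M.
Proof.
move=> Phicl; split; first exact: baire_separable.
exists M; first exact: baire_cauchy_complete.
by exists id, id; split=> // x.
Qed.

End BaireMetric.

(** * Analyticity of the sets of compressible orders *)

(** Continuity into a discrete target; the length of the deciding prefix may depend on [u]. *)
Definition loc T (f : (nat -> nat) -> T) :=
  forall u, exists n, forall v, agree n u v -> f v = f u.

Lemma agree_leq m n u v : m <= n -> agree n u v -> agree m u v.
Proof. by move=> mn uv i /leq_trans/(_ mn)/uv. Qed.

Lemma loc_eval k : loc (fun u => u k).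
Proof. by move=> u; exists k.+1 => v uv; rewrite uv. Qed.

(** The second query may depend on the answer to the first, as in nested readings of a witness; the
    longer of the two prefixes settles both. *)
Lemma loc_bind S T (f : (nat -> nat) -> S) (g : S -> (nat -> nat) -> T) :
  loc f -> (forall s, loc (g s)) -> loc (fun u => g (f u) u).
Proof.
move=> lf lg u; have [m mP] := lf u; have [n nP] := lg (f u) u.
exists (maxn m n) => v uv.
by rewrite mP ?nP//; apply: agree_leq uv; rewrite ?leq_maxl ?leq_maxr.
Qed.

Lemma loc_cst T (t : T) : loc (fun=> t).
Proof. by move=> u; exists 0. Qed.

Lemma loc_map S T (F : S -> T) f : loc f -> loc (fun u => F (f u)).
Proof. by move=> lf; apply: (loc_bind lf (g := fun s _ => F s)) => s; exact: loc_cst. Qed.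

Lemma loc_map2 S T W (F : S -> T -> W) f g :
  loc f -> loc g -> loc (fun u => F (f u) (g u)).
Proof.
by move=> lf lg; apply: (loc_bind lf (g := fun s u => F s (g u))) => s; exact: loc_map.
Qed.

Lemma baire_closed_forall I (P : I -> set (nat -> nat)) :
  (forall i, baire_closed (P i)) -> baire_closed (fun u => forall i, P i u).
Proof.
by move=> Pc u uP i; apply: Pc => n; have [v vP uv] := uP n; exists v.
Qed.

Lemma baire_closed_and (P Q : set (nat -> nat)) :
  baire_closed P -> baire_closed Q -> baire_closed (fun u => P u /\ Q u).
Proof.
move=> Pc Qc u uP; split; [apply: Pc|apply: Qc] => n;
  by have [v [Pv Qv] uv] := uP n; exists v.
Qed.

(** A prefix that fixes the value of [b] passes the premise on to the approximants of [u]. *)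
Lemma baire_closed_imp (b : (nat -> nat) -> bool) (P : set (nat -> nat)) :
  loc b -> baire_closed P -> baire_closed (fun u => b u -> P u).
Proof.
move=> lb Pc u uP bu; have [m mP] := lb u; apply: Pc => n.
have [v vP uv] := uP (maxn m n); exists v.
  by apply: vP; rewrite mP//; apply: agree_leq uv; rewrite leq_maxl.
by apply: agree_leq uv; rewrite leq_maxr.
Qed.

Lemma baire_closed_loc (b : (nat -> nat) -> bool) : loc b -> baire_closed b.
Proof. by move=> lb u uP; have [n nP] := lb u; have [v + /nP <-] := uP n. Qed.

Lemma baire_closed_ext (P Q : set (nat -> nat)) :
  (forall u, P u <-> Q u) -> baire_closed P -> baire_closed Q.
Proof.
by move=> PQ Pc u uP; apply/PQ/Pc => n; have [v /PQ] := uP n; exists v.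
Qed.

(** One sequence holds a relation, at the positions of the left summand, and countably many witness
    functions, at those of the right. A zero entry means that the bit is true, so every sequence
    yields a code. *)
Definition code_part (u : nat -> nat) : code :=
  fun p => u (pickle (inl p : (nat * nat) + (nat * nat))) == 0.

Definition witness_part (u : nat -> nat) (k n : nat) : nat :=
  u (pickle (inr (k, n) : (nat * nat) + (nat * nat))).

Definition join_parts (L : code) (w : nat -> nat -> nat) (n : nat) : nat :=
  if (unpickle n : option ((nat * nat) + (nat * nat))) is Some i then
    match i with inl p => ~~ L p | inr (k, m) => w k m end
  else 0.

Lemma code_part_join L w : code_part (join_parts L w) = L.
Proof.
by apply/funext => p; rewrite /code_part /join_parts pickleK; case: (L p).
Qed.

Lemma witness_part_join L w : witness_part (join_parts L w) = w.
Proof.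
by apply/funext => k; apply/funext => n; rewrite /witness_part /join_parts pickleK.
Qed.

Lemma loc_code_part p : loc (fun u => code_part u p).
Proof. exact: (loc_map (eq_op^~ 0) (loc_eval _)). Qed.

Lemma loc_code_rel f g : loc f -> loc g ->
  loc (fun u => code_rel (code_part u) (f u) (g u)).
Proof.
move=> lf lg.
apply: (loc_bind lf (g := fun x u => code_rel (code_part u) x (g u))) => x.
apply: (loc_bind lg (g := fun y u => code_rel (code_part u) x y)) => y.
exact: loc_code_part.
Qed.

Lemma loc_witness_part k f : loc f -> loc (fun u => witness_part u k (f u)).
Proof.
move=> lf; apply: (loc_bind lf (g := fun x u => witness_part u k x)) => x.
exact: loc_eval.
Qed.

Lemma baire_closed_linear_order :
  baire_closed (fun u => linear_order (code_rel (code_part u))).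
Proof.
pose r u := code_rel (code_part u).
have lr x y : loc (fun u => r u x y) by apply: loc_code_rel; exact: loc_cst.
apply: (@baire_closed_ext (fun u => forall x y z : nat,
  [&& r u x x, (r u x y && r u y x) ==> (x == y),
      (r u x y && r u y z) ==> r u x z & r u x y || r u y x])).
  move=> u; split=> [uP|[r1 r2 r3 r4] x y z]; last first.
    rewrite /r r1 r4 andbT /=; apply/andP; split; apply/implyP.
      by move=> /r2/eqP.
    by move=> /andP[]; exact: r3.
  split=> [x|x y|y x z|x y].
  - by have /and4P[] := uP x x x.
  - by have /and4P[_ /implyP xy _ _ /xy/eqP] := uP x y x.
  - by move=> rxy ryz; have /and4P[_ _ /implyP xy _] := uP x y z; apply: xy; rewrite -/(r u) in rxy ryz *; rewrite rxy ryz.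
  - by have /and4P[] := uP x y x.
do 3 apply: baire_closed_forall => ?.
apply: baire_closed_loc.
apply: (loc_map2 andb) => //; apply: (loc_map2 andb).
  by apply: (loc_map2 implb); [exact: (loc_map2 andb)|exact: loc_cst].
apply: (loc_map2 andb); last exact: (loc_map2 orb).
by apply: (loc_map2 implb) => //; exact: (loc_map2 andb).
Qed.

Lemma LO_linear (L : LO) : linear_order (code_rel (set_val L)).
Proof. by rewrite set_valE; case: L => L /= /set_mem. Qed.

(** The pairs of a linear order and a witness form a closed, hence Polish, subspace of the Baire
    space, and the projection to the order is continuous. *)
Lemma Sigma11_LO (R : realType) (P : rel nat -> (nat -> nat -> nat) -> Prop) :
  baire_closed (fun u => P (code_rel (code_part u)) (witness_part u)) ->
  Sigma11 R [set L : LO | exists w, P (code_rel (set_val L)) w].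
Proof.
move=> Pc.
pose Phi := [set u | linear_order (code_rel (code_part u)) /\
  P (code_rel (code_part u)) (witness_part u)].
have LOP (y : baire_sub R Phi) : code_part (sval y) \in LO.
  by apply/mem_set; case: y => ? [].
exists (baire_sub R Phi), (fun y => exist _ (code_part (sval y)) (LOP y)).
split.
- by apply: baire_sub_polish; apply: baire_closed_and => //; exact: baire_closed_linear_order.
- apply: continuous_LO => y p; have [n nP] := loc_code_part p (sval y).
  by apply: filterS (agree_nbhs y n) => y' /nP.
- apply/seteqP; split=> [L [w Lw]|_ [[u [Lu Pu]] _ <-]]; last first.
    by exists (witness_part u).
  have uP : Phi (join_parts (set_val L) w).
    by rewrite /Phi /= code_part_join witness_part_join; split=> //; exact: LO_linear.
  exists (exist _ _ uP) => //; apply: val_inj => /=.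
  by rewrite code_part_join.
Qed.

(** * Compressibility through embeddings *)

Section Compress.
Variable C : Type.

(** For a linear order, [g] embeds it onto an initial segment and [b] lies above the range. The
    function [h] skolemizes downward closure of the range: once [g], [h], [b] are given only
    universal quantifiers remain, so the condition is closed. *)
Definition compresses (r : rel C) (g h : C -> C) (b : C) :=
  [/\ forall x y, r (g x) (g y) = r x y,
      forall x y, r y (g x) -> g (h y) = y &
      forall x, ~~ r b (g x)].

Definition compressible (r : rel C) := exists g h b, compresses r g h b.

End Compress.

Lemma right_compressibleP r : linear_order r ->
  right_compressible r <-> compressible r.
Proof.
move=> [rr ra rt rT]; split=> [[A [B [[AB0 AB1 AB] [f [fA finj fsurj] fr] [b Bb]]]]|].
  have /choice[g gP] : forall x, exists a, A a /\ f a = x.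
    by move=> x; have [a Aa fa] := fsurj x I; exists a.
  have disj y : A y -> B y -> False.
    by move=> Ay By; have : (A `&` B) y by []; rewrite AB1.
  exists g, f, b; split=> [x y|x y yx|x].
  - have [Ax fx] := gP x; have [Ay fy] := gP y.
    by rewrite -(fr _ _ (mem_set Ax) (mem_set Ay)) fx fy.
  - have [Ax fx] := gP x; have : (A `|` B) y by rewrite AB0.
    case=> [Ay|By].
      by have [Ay' fy] := gP (f y); apply: finj => //; exact: mem_set.
    have yg : y = g x by apply: ra; rewrite yx AB.
    by rewrite yg in By; have := disj _ Ax By.
  - apply/negP => bx; have [Ax fx] := gP x.
    have bg : b = g x by apply: ra; rewrite bx AB.
    by rewrite bg in Bb; have := disj _ Ax Bb.
move=> [g [h [b [gr gh bg]]]].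
have ginj : injective g.
  by move=> x y xy; apply: ra; rewrite -(gr x y) -(gr y x) xy rr.
have hg x : h (g x) = x by apply/ginj/(gh x).
exists (range g), (~` range g); split.
- split; [exact: setUv|exact: setICr|].
  move=> _ y [x _ <-] ny; have /orP[//|/gh yg] := rT (g x) y.
  by exfalso; apply: ny; exists (h y).
- exists h.
    split=> [//|_ _ /set_mem[x _ <-] /set_mem[y _ <-]|x _]; first by rewrite !hg => ->.
    by exists (g x).
  by move=> _ _ /set_mem[x _ <-] /set_mem[y _ <-]; rewrite !hg gr.
- by exists b => -[x _ xb]; have := bg x; rewrite xb rr.
Qed.

Lemma linear_order_op r : linear_order r -> linear_order (fun x y => r y x).
Proof.
move=> [rr ra rt rT]; split=> // [x y|y x z xy yz].
- by rewrite andbC; exact: ra.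
- exact: rt yz xy.
Qed.

(** Passing to the opposite order exchanges the two summands of a decomposition. *)
Lemma left_compressibleP r : linear_order r ->
  left_compressible r <-> compressible (fun x y => r y x).
Proof.
move=> /linear_order_op/right_compressibleP <-.
split=> -[A [B [[AB0 AB1 AB] [f fb fr] nb]]]; exists B, A; split=> //.
- by split=> [||x y Bx Ay]; rewrite 1?setUC 1?setIC//; exact: AB.
- by exists f => // x y xB yB; exact: fr.
- by split=> [||x y Bx Ay]; rewrite 1?setUC 1?setIC//; exact: AB.
- by exists f => // x y xB yB; exact: fr.
Qed.

(** The offset [k] lets two compressions share one witness: right ones occupy rows 0 to 2, left ones
    rows 3 to 5. *)
Lemma baire_closed_compresses (r : (nat -> nat) -> rel nat) (k : nat) :
  (forall f g, loc f -> loc g -> loc (fun u => r u (f u) (g u))) ->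
  baire_closed (fun u => compresses (r u)
    (witness_part u k) (witness_part u k.+1) (witness_part u k.+2 0)).
Proof.
move=> lr; pose w := witness_part.
have lw i x : loc (fun u => w u i x) by apply: loc_witness_part; exact: loc_cst.
apply: (@baire_closed_ext (fun u => forall x y : nat,
  [&& r u (w u k x) (w u k y) == r u x y,
      r u y (w u k x) ==> (w u k (w u k.+1 y) == y) &
      ~~ r u (w u k.+2 0) (w u k x)])).
  move=> u; split=> [uP|[r1 r2 r3] x y]; last first.
    by rewrite /w r1 r3 eqxx andbT; apply/implyP => /r2/eqP.
  split=> [x y|x y ryx|x].
  - by have /and3P[/eqP] := uP x y.
  - by have /and3P[_ /implyP xy _] := uP x y; apply/eqP/xy.
  - by have /and3P[] := uP x x.
do 2 apply: baire_closed_forall => ?; apply: baire_closed_loc.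
apply: (loc_map2 andb); [|apply: (loc_map2 andb)].
- apply: (loc_map2 eq_op); apply: lr; by [exact: loc_cst|exact: lw].
- apply: (loc_map2 implb); first by apply: lr; [exact: loc_cst|exact: lw].
  apply: (loc_map (fun n => n == _)); apply: loc_witness_part; exact: lw.
- by apply: (loc_map negb); apply: lr; exact: lw.
Qed.

Definition compresses_right (r : rel nat) (w : nat -> nat -> nat) :=
  compresses r (w 0) (w 1) (w 2 0).

Definition compresses_left (r : rel nat) (w : nat -> nat -> nat) :=
  compresses (fun x y => r y x) (w 3) (w 4) (w 5 0).

Lemma baire_closed_right :
  baire_closed (fun u => compresses_right (code_rel (code_part u)) (witness_part u)).
Proof.
have lr f g : loc f -> loc g -> loc (fun u => code_rel (code_part u) (f u) (g u)).
  exact: loc_code_rel.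
exact: (@baire_closed_compresses (fun u => code_rel (code_part u)) 0 lr).
Qed.

Lemma baire_closed_left :
  baire_closed (fun u => compresses_left (code_rel (code_part u)) (witness_part u)).
Proof.
have lr f g : loc f -> loc g -> loc (fun u => code_rel (code_part u) (g u) (f u)).
  by move=> lf lg; exact: loc_code_rel.
exact: (@baire_closed_compresses (fun u x y => code_rel (code_part u) y x) 3 lr).
Qed.

Definition witness3 (g h : nat -> nat) (b k : nat) : nat -> nat :=
  match k with 0 => g | 1 => h | _ => fun=> b end.

Lemma LO_rE (L : LO) :
  LO_r L <-> exists w, compresses_right (code_rel (set_val L)) w.
Proof.
have Llin := LO_linear L.
rewrite /LO_r /= right_compressibleP//; split=> [[g [h [b Lghb]]]|[w Lw]].
  by exists (witness3 g h b).
by exists (w 0), (w 1), (w 2 0).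
Qed.

Lemma LO_lE (L : LO) :
  LO_l L <-> exists w, compresses_left (code_rel (set_val L)) w.
Proof.
have Llin := LO_linear L.
rewrite /LO_l /= left_compressibleP//; split=> [[g [h [b Lghb]]]|[w Lw]].
  by exists (fun k => witness3 g h b (k - 3)).
by exists (w 3), (w 4), (w 5 0).
Qed.

Lemma Sigma11_LO_r (R : realType) : Sigma11 R LO_r.
Proof.
have := Sigma11_LO R baire_closed_right; congr Sigma11.
by apply/seteqP; split=> L /LO_rE.
Qed.

Lemma Sigma11_LO_l (R : realType) : Sigma11 R LO_l.
Proof.
have := Sigma11_LO R baire_closed_left; congr Sigma11.
by apply/seteqP; split=> L /LO_lE.
Qed.

Lemma Sigma11_LO_rI (R : realType) : Sigma11 R (LO_r `&` LO_l).
Proof.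
have := Sigma11_LO R (P := fun r w => compresses_right r w /\ compresses_left r w)
  (baire_closed_and baire_closed_right baire_closed_left).
congr Sigma11; apply/seteqP; split=> L.
  by move=> [w [wr wl]]; split; [apply/LO_rE|apply/LO_lE]; exists w.
move=> [/LO_rE[w wr] /LO_lE[w' wl]].
by exists (fun k => if k < 3 then w k else w' k).
Qed.

(** The entry [w 6 0] is a flag: zero announces a right compression, any other value a left one. The
    disjunction becomes two implications with locally determined premises, which are closed. *)
Lemma Sigma11_LO_rU (R : realType) : Sigma11 R (LO_r `|` LO_l).
Proof.
have := Sigma11_LO R (P := fun r w => (w 6 0 == 0 -> compresses_right r w) /\
  (w 6 0 != 0 -> compresses_left r w)) _.
set H := (X in (X -> _) -> _).
have hH : H.
  have lw : loc (fun u => witness_part u 6 0).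
    by apply: loc_witness_part; exact: loc_cst.
  apply: baire_closed_and; apply: baire_closed_imp.
  - exact: (loc_map (eq_op^~ 0) lw).
  - exact: baire_closed_right.
  - exact: (loc_map (fun n => n != 0) lw).
  - exact: baire_closed_left.
move=> /(_ hH); congr Sigma11; apply/seteqP; split=> L.
  move=> [w [wr wl]]; have [w0|w0] := eqVneq (w 6 0) 0.
    by left; apply/LO_rE; exists w; apply: wr; rewrite w0.
  by right; apply/LO_lE; exists w; exact: wl.
move=> [/LO_rE[w wr]|/LO_lE[w wl]].
  (* The default value of the remaining rows sets the flag: 0 here, 1 in the left case. *)
  by exists (fun k => if k < 3 then w k else fun=> 0).
by exists (fun k => if k < 6 then w k else fun=> 1).
Qed.

(** * Back and forth *)

Definition strict_total C (r : rel C) :=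
  [/\ irreflexive r, transitive r & forall x y, [\/ x = y, r x y | r y x]].

Section BackAndForth.
Variables (U : countType) (r : rel U) (m : U).
Hypothesis rst : strict_total r.

Let rirr : irreflexive r. Proof. by case: rst. Qed.
Let rtr : transitive r. Proof. by case: rst. Qed.
Let rtot x y : [\/ x = y, r x y | r y x]. Proof. by case: rst. Qed.

(** Dense with least element [m] and no greatest: the last clause covers density, and absence of a
    maximum when [s] is empty. A whole list of upper bounds is what one extension step of a finite
    partial isomorphism has to respect. *)
Definition dense_above (P : set U) :=
  [/\ P m, forall x, P x -> x = m \/ r m x &
      forall x (s : seq U), P x -> (forall y, y \in s -> P y /\ r x y) ->
        exists z, [/\ P z, r x z & forall y, y \in s -> r z y]].

Definition partial_iso (P Q : set U) (p : seq (U * U)) :=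
  [/\ (m, m) \in p, forall a b, (a, b) \in p -> P a /\ Q b &
      forall a b c d, (a, b) \in p -> (c, d) \in p -> r a c = r b d].

Lemma exists_max (T : eqType) (f : T -> U) (s : seq T) x :
  x \in s -> exists2 y, y \in s & forall z, z \in s -> f z = f y \/ r (f z) (f y).
Proof.
elim: s x => // t s IH x _; case: s IH => [|t' s] IH.
  by exists t; rewrite ?mem_head// => z /[!inE]/eqP->; left.
have [|y ys ymax] := IH t'; first exact: mem_head.
have [ty|ty|yt] := rtot (f t) (f y).
- by exists y; rewrite 1?inE ?ys ?orbT// => z; rewrite inE => /orP[/eqP->|/ymax]//; left.
- by exists y; rewrite 1?inE ?ys ?orbT// => z; rewrite inE => /orP[/eqP->|/ymax]//; right.
- exists t; rewrite ?mem_head// => z; rewrite inE => /orP[/eqP->|/ymax[->|zy]]; [by left|by right|].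
  by right; exact: rtr zy yt.
Qed.

(** For a new [a], let [c] be the largest point of the domain below it; it exists because [(m, m)]
    is in [p]. Density of [Q] gives a point [b] above the image of [c] and below the images of all
    domain points above [a]. *)
Lemma partial_iso_extend P Q p a : dense_above P -> dense_above Q ->
  partial_iso P Q p -> P a -> exists b, partial_iso P Q ((a, b) :: p).
Proof.
move=> [Pm Pmin _] [Qm Qmin Qd] [mp pPQ pr] Pa.
have [/mapP[[a' b] abp /= ea]|ap] := boolP (a \in map fst p).
  rewrite -{a'}ea in abp.
  have sub x : x \in (a, b) :: p -> x \in p by rewrite inE => /orP[/eqP->|].
  exists b; split=> [|c d /sub/pPQ//|c d e f /sub cd /sub ef]; last exact: pr.
  by rewrite inE mp orbT.
have ma : r m a.
  by case: (Pmin a Pa) => // am; case/negP: ap; rewrite am; apply/mapP; exists (m, m).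
have mlo : (m, m) \in [seq q <- p | r q.1 a] by rewrite mem_filter ma.
have [[c d] + cmax] := exists_max fst mlo.
rewrite mem_filter => /andP[/= ca cdp].
have [|y|b [Qb db bhi]] := Qd d [seq q.2 | q <- p & r a q.1].
- by have [] := pPQ _ _ cdp.
- case/mapP => -[e f]; rewrite mem_filter /= => /andP[ae ef] ->.
  have [_ Qf] := pPQ _ _ ef; split=> //.
  by rewrite -(pr _ _ _ _ cdp ef); exact: rtr ca ae.
have below e f : (e, f) \in p -> r e a -> r f b.
  move=> ef ea; have := cmax (e, f); rewrite mem_filter /= ea ef => /(_ isT)[ec|ec].
    suff -> : f = d by [].
    by have [//| |] := rtot f d; rewrite ?(esym (pr _ _ _ _ ef cdp)) ?(esym (pr _ _ _ _ cdp ef)) ec rirr.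
  by apply: rtr db; rewrite -(pr _ _ _ _ ef cdp).
have above e f : (e, f) \in p -> r a e -> r b f.
  by move=> ef ae; apply: bhi; apply/mapP; exists (e, f); rewrite ?mem_filter ?ae.
have asym x y : r x y -> r y x = false.
  by move=> xy; apply/negP => yx; have := rtr xy yx; rewrite rirr.
have cmp e f : (e, f) \in p -> r e a = r f b /\ r a e = r b f.
  move=> ef; have [ea|ea|ae] := rtot e a.
  - by case/negP: ap; rewrite -ea; apply/mapP; exists (e, f).
  - by have fb := below _ _ ef ea; rewrite ea fb (asym _ _ ea) (asym _ _ fb).
  - by have bf := above _ _ ef ae; rewrite ae bf (asym _ _ ae) (asym _ _ bf).
exists b; split=> [|e f|e f g h].
- by rewrite inE mp orbT.
- by rewrite inE => /orP[/eqP[-> ->]//|]; exact: pPQ.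
- rewrite !inE => /orP[/eqP[-> ->]|ef] /orP[/eqP[-> ->]|gh].
  + by rewrite !rirr.
  + by have [] := cmp _ _ gh.
  + by have [] := cmp _ _ ef.
  + exact: pr.
Qed.

Definition swap (q : U * U) := (q.2, q.1).

Lemma mem_swap a b p : ((a, b) \in map swap p) = ((b, a) \in p).
Proof.
apply/mapP/idP => [[[c d] cd [-> ->]]//|ba].
by exists (b, a).
Qed.

Lemma partial_iso_swap P Q p : partial_iso P Q p -> partial_iso Q P (map swap p).
Proof.
move=> [mp pPQ pr]; split=> [|a b|a b c d]; rewrite !mem_swap//.
  by move=> /pPQ[].
by move=> ab cd; rewrite (pr _ _ _ _ ab cd).
Qed.

(** Cantor's theorem for countable dense orders with a least element and no greatest. The maps are
    total on [U] but constrained only on [P] and [Q]. *)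
Lemma back_and_forth P Q : dense_above P -> dense_above Q ->
  exists h k : U -> U, [/\ forall a, P a -> Q (h a) /\ k (h a) = a,
    forall b, Q b -> P (k b) /\ h (k b) = b &
    forall a c, P a -> P c -> r (h a) (h c) = r a c].
Proof.
move=> Pd Qd; pose good := {p | partial_iso P Q p}.
(* Stage [n] puts the element with code [n] into the domain, then into the range by extending the
   swapped isomorphism. *)
have step (pn : good * nat) : exists p' : good, [/\ {subset sval pn.1 <= sval p'},
    forall a, unpickle pn.2 = Some a -> P a -> exists b, (a, b) \in sval p' &
    forall b, unpickle pn.2 = Some b -> Q b -> exists a, (a, b) \in sval p'].
  case: pn => -[p pP] n /=; case: (unpickle n) => [c|]; last by exists (exist _ p pP); split.
  have [p1 [p1P pp1 cp1]] : exists p1, [/\ partial_iso P Q p1, {subset p <= p1} &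
      P c -> exists b, (c, b) \in p1].
    have [Pc|nPc] := pselect (P c); last by exists p; split.
    have [b bP] := partial_iso_extend Pd Qd pP Pc.
    exists ((c, b) :: p); split=> // [x xp|_]; first by rewrite inE xp orbT.
    by exists b; rewrite mem_head.
  have [Qc|nQc] := pselect (Q c); last first.
    by exists (exist _ p1 p1P); split=> //= [a [<-] /cp1|b [<-]].
  have [a aP] := partial_iso_extend Qd Pd (partial_iso_swap p1P) Qc.
  have sub x y : (x, y) \in p1 -> (x, y) \in map swap ((c, a) :: map swap p1).
    by move=> xy; rewrite mem_swap inE mem_swap xy orbT.
  exists (exist _ _ (partial_iso_swap aP)); split=> /= [[x y] /pp1/sub//|x [<-] /cp1[b]|b [<-] _].
    by move=> /sub; exists b.
  by exists a; rewrite inE eqxx.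
have [F FP] := choice step.
have p0P : partial_iso P Q [:: (m, m)].
  have [Pm _ _] := Pd; have [Qm _ _] := Qd.
  split=> [|a b|a b c d]; rewrite ?mem_head// !inE => /eqP[-> ->]//.
  by move=> /eqP[-> ->].
pose fix st n : good := if n is k.+1 then F (st k, k) else exist _ _ p0P.
have st_sub n k : n <= k -> {subset sval (st n) <= sval (st k)}.
  elim: k => [|k IH]; first by rewrite leqn0 => /eqP->.
  rewrite leq_eqVlt => /orP[/eqP->//|]; rewrite ltnS => /IH nk x /nk.
  by have [+ _ _] := FP (st k, k); apply.
pose G a b := exists n, (a, b) \in sval (st n).
have Gr a b c d : G a b -> G c d -> r a c = r b d.
  move=> [i ab] [j cd]; have [_ _] := svalP (st (maxn i j)); apply.
    by apply: st_sub ab; exact: leq_maxl.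
  by apply: st_sub cd; exact: leq_maxr.
have GP a b : G a b -> P a /\ Q b.
  by move=> [n ab]; have [_ + _] := svalP (st n); apply.
have /choice[h hP] a : exists b, P a -> G a b.
  have [Pa|nPa] := pselect (P a); last by exists a.
  have [_ /(_ a) + _] := FP (st (pickle a), pickle a).
  by rewrite /= pickleK => /(_ erefl Pa)[b ab]; exists b => _; exists (pickle a).+1.
have /choice[k kP] b : exists a, Q b -> G a b.
  have [Qb|nQb] := pselect (Q b); last by exists b.
  have [_ _ /(_ b)] := FP (st (pickle b), pickle b).
  by rewrite /= pickleK => /(_ erefl Qb)[a ab]; exists a => _; exists (pickle b).+1.
have Gl a a' b : G a b -> G a' b -> a = a'.
  move=> ab ab'; have [//| |] := rtot a a'.
    by rewrite (Gr _ _ _ _ ab ab') rirr.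
  by rewrite (Gr _ _ _ _ ab' ab) rirr.
have Gri a b b' : G a b -> G a b' -> b = b'.
  move=> ab ab'; have [//| |] := rtot b b'.
    by rewrite -(Gr _ _ _ _ ab ab') rirr.
  by rewrite -(Gr _ _ _ _ ab' ab) rirr.
exists h, k; split=> [a Pa|b Qb|a c Pa Pc].
- have ab := hP a Pa; have [_ Qb] := GP _ _ ab; split=> //.
  exact: Gl (kP _ Qb) ab.
- have ab := kP b Qb; have [Pa _] := GP _ _ ab; split=> //.
  exact: Gri (hP _ Pa) ab.
- by rewrite (Gr _ _ _ _ (hP _ Pa) (hP _ Pc)).
Qed.

End BackAndForth.

(** * Lexicographic orders on descending sequences *)

Section Lex.
Variables (N : eqType) (e : bool) (lt : rel N).

(** The bit [e] places prefixes: with [true] a prefix precedes its extensions, as in the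
    exponential; with [false] it follows them, as in the Kleene-Brouwer order. *)
Fixpoint lex (s t : seq N) : bool :=
  match s, t with
  | [::], [::] => false
  | [::], _ :: _ => e
  | _ :: _, [::] => ~~ e
  | x :: s', y :: t' => lt x y || (x == y) && lex s' t'
  end.

Lemma lex_strict_total : strict_total lt -> strict_total lex.
Proof.
move=> [lirr ltr ltot]; split.
- by elim=> //= x s ->; rewrite lirr andbF.
- move=> t s; elim: s t => [|x s IH] [|y t] [|z u] //=; try by case: e.
  move=> /orP[xy|/andP[/eqP-> st]] /orP[yz|/andP[/eqP<- tu]].
  + by rewrite (ltr _ _ _ xy yz).
  + by rewrite xy.
  + by rewrite yz.
  + by rewrite eqxx (IH _ _ st tu) orbT.
- elim=> [|x s IH] [|y t] //=; [exact: Or31|..].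
  + by case: (e); [apply: Or32|apply: Or33].
  + by case: (e); [apply: Or33|apply: Or32].
  + have [->|xy|yx] := ltot x y.
    * by rewrite eqxx lirr; have [->|->|->] := IH t; [apply: Or31|apply: Or32|apply: Or33].
    * by rewrite xy; apply: Or32.
    * by rewrite yx; apply: Or33.
Qed.

Lemma lex_catl s t u : strict_total lt -> lex (s ++ t) (s ++ u) = lex t u.
Proof. by move=> [lirr _ _]; elim: s => //= x s ->; rewrite lirr eqxx. Qed.

End Lex.

Lemma strict_total_asym C (lt : rel C) x y :
  strict_total lt -> lt x y -> lt y x = false.
Proof.
move=> [lirr ltr _] xy; apply/negP => yx.
by have := ltr _ _ _ xy yx; rewrite lirr.
Qed.

Lemma strict_total_le_lt C (lt : rel C) x y z :
  strict_total lt -> ~~ lt y x -> lt y z -> lt x z.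
Proof.
move=> [_ ltr ltot] yx yz; have [->//|xy|] := ltot x y; first exact: ltr yz.
by move=> /(negP yx).
Qed.

(** The counterpart of [compresses] for strict orders. *)
Definition compresses_lt C (lt : rel C) (g h : C -> C) (b : C) :=
  [/\ forall x y, lt (g x) (g y) = lt x y,
      forall x y, ~~ lt (g x) y -> g (h y) = y &
      forall x, lt (g x) b].

Section DescendingLists.
Variables (N : countType) (lt : rel N) (T : pred N).
Hypothesis lst : strict_total lt.

Let lirr : irreflexive lt. Proof. by case: lst. Qed.
Let ltr : transitive lt. Proof. by case: lst. Qed.
Let ltot x y : [\/ x = y, lt x y | lt y x]. Proof. by case: lst. Qed.

Definition descending (l : seq N) := all T l && pairwise (fun x y => lt y x) l.

(* Lists that are not descending are put at the bottom, in order type at most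
   omega, so that the domain of the order does not depend on [T]. *)
Definition desc_lt (l l' : seq N) :=
  if descending l then descending l' && lex true lt l l'
  else descending l' || (pickle l < pickle l').

Lemma desc_lt_strict_total : strict_total desc_lt.
Proof.
have [xirr xtr xtot] := lex_strict_total true lst.
rewrite /desc_lt; split=> [l|l' l l''|l l'].
- by case: (descending l); rewrite /= ?xirr ?ltnn.
- case: (descending l); case: (descending l'); case: (descending l'') => //=.
    exact: xtr.
  exact: ltn_trans.
- case: (descending l); case: (descending l') => //=.
  + exact: Or33.
  + exact: Or32.
  + have [|] := eqVneq (pickle l) (pickle l').
      by move=> /(pcan_inj pickleK) ->; apply: Or31.
    by rewrite neq_ltn => /orP[ll|ll]; [apply: Or32|apply: Or33].
Qed.

Definition below (y x : N) := [/\ T y, T x & lt y x].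

(** The ill-founded part of [T]. It is upward closed since predecessors of accessible points are
    accessible, and has no minimum since a point with only accessible predecessors is accessible. *)
Definition nonacc (x : N) := T x /\ ~ Acc below x.

Lemma nonacc_up x y : nonacc x -> T y -> lt x y -> nonacc y.
Proof.
by move=> [Tx xacc] Ty xy; split=> // -[yacc]; apply/xacc/yacc.
Qed.

Lemma nonacc_down x : nonacc x -> exists2 y, nonacc y & lt y x.
Proof.
move=> [Tx xacc]; apply: contrapT => nex; apply: xacc; constructor.
move=> y [Ty _ yx]; apply: contrapT => yacc; apply: nex; exists y => //.
Qed.

(** If [l] is a proper prefix of [l'], the new entry [y] is below the next entry of [l']; otherwise
    an earlier position already decides. *)
Lemma lex_rcons l l' y : lex true lt l l' -> all (lt y) l' ->
  lex true lt (rcons l y) l'.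
Proof.
elim: l l' => [|x l IH] [|x' l'] //=; first by move=> _ /andP[->].
by move=> /orP[->//|/andP[-> /IH ll]] /andP[_ /ll->]; rewrite orbT.
Qed.

(** The head of a descending list dominates its other entries. Thus [[:: x]] cuts off exactly the
    descending lists with entries below [x]. *)
Lemma lex_seq1 l x : pairwise (fun x y => lt y x) l ->
  lex true lt l [:: x] = all (lt^~ x) l.
Proof.
case: l => //= a l /andP[al _]; rewrite [lex _ _ _ _](_ : _ = false) ?andbF ?orbF.
  have [ax|//] := boolP (lt a x); apply/esym/allP => b bl.
  by apply: ltr ax; move/allP: al; exact.
by case: l {al}.
Qed.

(** The delicate case is [a1] a proper prefix of [a2]: the next entry of [a2] is in [A], hence above
    the first entry of [w1], and if [w1] is empty the prefix comes first anyway. The case with [a1]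
    and [a2] exchanged is symmetric. *)
Lemma lex_cat (A : pred N) a1 a2 w1 w2 :
  (forall x y, A x -> ~~ A y -> y \in w1 ++ w2 -> lt y x) ->
  all A a1 -> all A a2 -> all (predC A) w1 -> all (predC A) w2 ->
  lex true lt (a1 ++ w1) (a2 ++ w2) =
  lex true lt a1 a2 || (a1 == a2) && lex true lt w1 w2.
Proof.
move=> WA; elim: a1 a2 => [|x a1 IH] [|y a2] //=.
- case: w1 WA => [|x w1]//= WA _ /andP[Ay _] /andP[Ax _] _.
  by rewrite (WA y x) ?mem_head.
- case: w2 WA {IH} => [|y w2]//= WA /andP[Ax _] _ w1A /andP[Ay _].
  have yx : lt y x by rewrite (WA x y)// mem_cat mem_head orbT.
  rewrite (strict_total_asym lst yx); case: eqP => // xy.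
  by move: yx; rewrite xy lirr.
- move=> /andP[Ax a1A] /andP[Ay a2A] w1A w2A; rewrite IH// eqseq_cons.
  by rewrite -orbA andb_orr andbA.
Qed.

Definition desc_in (A : set N) : set (seq N) :=
  [set l | descending l /\ forall x, x \in l -> A x].

(** To fit a list between [l] and finitely many larger ones, append to [l] a point of [A] below
    every entry of all these lists; it exists as [A] has no minimum. *)
Lemma dense_above_descending (A : set N) :
  (exists x, A x) -> (forall x, A x -> exists2 y, A y & lt y x) ->
  (forall x, A x -> T x) ->
  dense_above (lex true lt) [::] (desc_in A).
Proof.
move=> [a Aa] Adown AT.
have Abelow s : (forall x, x \in s -> A x) -> exists2 y, A y & all (lt y) s.
  elim: s => [|x s IH] sA; first by exists a.
  have [|y Ay ys] := IH; first by move=> z zs; apply: sA; rewrite inE zs orbT.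
  have Ax : A x by apply: sA; rewrite mem_head.
  have ysall z : lt z y -> all (lt z) s.
    by move=> zy; apply/allP => t ts; apply: ltr zy _; move/allP: ys; exact.
  have [yx|yx|xy] := ltot y x.
  - have [z Az zx] := Adown _ Ax; exists z => //=.
    by rewrite zx ysall// yx.
  - by exists y => //=; rewrite yx.
  - have [z Az zx] := Adown _ Ax; exists z => //=.
    by rewrite zx ysall//; exact: ltr zx xy.
split=> [//|[|x l] _|l s [ld lA] sP]; [by left|by right|].
have [|y Ay] := Abelow (flatten (l :: s)).
  move=> x /flattenP[l' + xl']; rewrite inE => /orP[/eqP ll|/sP[[_ l'A] _]].
    by apply: lA; rewrite -ll.
  exact: l'A.
rewrite /= all_cat => /andP[yl ys]; exists (rcons l y); split.
- split.
    move/andP: ld => [lT lp]; rewrite /descending all_rcons lT AT//=.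
    by rewrite -cats1 pairwise_cat lp allrel1r /= andbT.
  by move=> x; rewrite mem_rcons inE => /orP[/eqP->//|/lA].
- by rewrite -cats1 -[X in lex _ _ X _]cats0 lex_catl.
- move=> l' l's; have [_ ll'] := sP _ l's; apply: lex_rcons => //.
  by apply/allP => x xl'; move/allP: ys; apply; apply/flattenP; exists l'.
Qed.

Let R : pred N := fun y => `[< nonacc y >].

Lemma notR_lt x y : nonacc x -> T y -> ~~ R y -> lt y x.
Proof.
move=> Rx Ty /asboolP nRy; have [yx|//|xy] := ltot y x.
  by case: nRy; rewrite yx.
by case: nRy; exact: nonacc_up xy.
Qed.

(** As [R] is upward closed in [T], a descending list that has left [R] never returns to it. *)
Lemma descendingE l : descending l -> l = seq.filter R l ++ seq.filter (predC R) l.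
Proof.
elim: l => //= a l IH /andP[/= /andP[Ta lT] /andP[la lp]].
have {}IH := IH (introT andP (conj lT lp)).
have [/asboolP Ra|nRa] := boolP (R a); first by rewrite /= -IH.
suff fl : seq.filter R l = [::] by rewrite {1}IH fl.
apply/eqP; rewrite -[_ == _]negbK -has_filter; apply/hasPn => y yl.
apply/negP => /asboolP Ry; move/asboolP: nRa; apply.
by apply: nonacc_up Ry Ta _; move/allP: la; exact.
Qed.

Lemma descending_filter p l : descending l -> descending (seq.filter p l).
Proof.
move=> /andP[lT lp]; rewrite /descending all_filter.
rewrite (subseq_pairwise (filter_subseq _ _) lp) andbT.
by apply/allP => x /(allP lT) /= ->; rewrite implybT.
Qed.

Lemma desc_in_filter l : descending l -> desc_in nonacc (seq.filter R l).
Proof.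
move=> ld; split; first exact: descending_filter.
by move=> x; rewrite mem_filter => /andP[/asboolP].
Qed.

Definition act (f : seq N -> seq N) (l : seq N) :=
  if descending l then f (seq.filter R l) ++ seq.filter (predC R) l else l.

Lemma act_descending f l : desc_in nonacc (f (seq.filter R l)) -> descending l ->
  [/\ descending (act f l), seq.filter R (act f l) = f (seq.filter R l) &
      seq.filter (predC R) (act f l) = seq.filter (predC R) l].
Proof.
move=> [fd fR] ld; rewrite /act ld; split.
- have /andP[fT fp] := fd; have /andP[lT lp] := descending_filter (predC R) ld.
  rewrite /descending all_cat fT lT pairwise_cat fp lp !andbT /=.
  apply/allrelP => x y /fR Rx; rewrite mem_filter => /andP[nRy yl].
  by apply: notR_lt => //; move/andP: ld => [/allP + _]; exact.
- rewrite filter_cat -filter_predI (@eq_filter _ (predI R (predC R)) pred0); last first.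
    by move=> y /=; rewrite andbN.
  rewrite filter_pred0 cats0; apply/all_filterP/allP => x /fR Rx.
  exact/asboolP.
- rewrite filter_cat filter_id -[RHS]cat0s; congr cat.
  apply/eqP; rewrite -[_ == _]negbK -has_filter; apply/hasPn => x /fR Rx /=.
  by rewrite negbK; exact/asboolP.
Qed.

(** The back-and-forth map acts on the entries in [R] and leaves the accessible tail alone. The
    range consists of the non-descending lists and the descending lists with all entries below [x]:
    an initial segment bounded by [[:: x]]. *)
Lemma desc_lt_compresses : (exists x, nonacc x) ->
  exists g h b, compresses_lt desc_lt g h b.
Proof.
move=> [x Rx]; have [Tx _] := Rx.
have Pd : dense_above (lex true lt) [::] (desc_in nonacc).
  apply: dense_above_descending; [by exists x|exact: nonacc_down|by move=> y []].
have Qd : dense_above (lex true lt) [::] (desc_in [set y | nonacc y /\ lt y x]).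
  apply: dense_above_descending.
  - by have [y Ry yx] := nonacc_down Rx; exists y.
  - move=> y [Ry yx]; have [z Rz zy] := nonacc_down Ry; exists z => //.
    by split=> //; exact: ltr zy yx.
  - by move=> y [[]].
have lxst := lex_strict_total true lst.
have [h [k [hP kQ hr]]] := back_and_forth lxst Pd Qd.
have QP l : desc_in [set y | nonacc y /\ lt y x] l -> desc_in nonacc l.
  by move=> [ld lQ]; split=> // y /lQ[].
have hPP l : desc_in nonacc l -> desc_in nonacc (h l) by move=> /hP[/QP].
have actd l : descending (act h l) = descending l.
  have [ld|/negbTE ld] := boolP (descending l); last by rewrite /act ld ld.
  by have [] := act_descending (hPP _ (desc_in_filter ld)) ld.
have ltx l : descending l -> all (lt^~ x) (act h l).
  move=> ld; rewrite /act ld all_cat; apply/andP; split; apply/allP => y.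
    by have [[_ + _]] := hP _ (desc_in_filter ld) => /[apply] -[].
  rewrite mem_filter => /andP[nRy yl]; apply: notR_lt => //.
  by move/andP: ld => [/allP + _]; exact.
have dx : descending [:: x] by rewrite /descending /= Tx.
exists (act h), (act k), [:: x]; split=> [l l'|l y|l].
- rewrite /desc_lt !actd.
  have [ld|ld] := boolP (descending l); last by rewrite /act (negbTE ld); case: ifP.
  have [ld'|//] := boolP (descending l'); rewrite /=.
  have Pl := desc_in_filter ld; have Pl' := desc_in_filter ld'.
  have cmp a a' : desc_in nonacc a -> desc_in nonacc a' ->
      lex true lt (a ++ seq.filter (predC R) l) (a' ++ seq.filter (predC R) l') =
      lex true lt a a' ||
        (a == a') && lex true lt (seq.filter (predC R) l) (seq.filter (predC R) l').
    move=> [_ aR] [_ a'R]; apply: (lex_cat (A := R)).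
    + move=> z y /asboolP Rz nRy; rewrite mem_cat !mem_filter => yl.
      apply: notR_lt => //; case/orP: yl => /andP[_].
        by move/andP: ld => [/allP + _]; exact.
      by move/andP: ld' => [/allP + _]; exact.
    + by apply/allP => z /aR Rz; exact/asboolP.
    + by apply/allP => z /a'R Rz; exact/asboolP.
    + exact: filter_all.
    + exact: filter_all.
  rewrite [in RHS](descendingE ld) [in RHS](descendingE ld') cmp//.
  rewrite /act ld ld' cmp; [|exact: hPP|exact: hPP].
  rewrite hr//; congr (_ || _ && _); apply/eqP/eqP => [hh|->//].
  by have [_ <-] := hP _ Pl; have [_ <-] := hP _ Pl'; rewrite hh.
- rewrite /desc_lt actd; have [yd|yd] := boolP (descending y); last first.
    by rewrite /act (negbTE yd) (negbTE yd).
  have [ld /= yl|//] := boolP (descending l).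
  (* A descending list that is at most [act h l] is below [[:: x]], so its entries are all below
     [x]. *)
  have yx : all (lt^~ x) y.
    have /andP[_ yp] := yd; rewrite -lex_seq1//.
    apply: (strict_total_le_lt lxst yl); rewrite lex_seq1; first exact: ltx.
    by have : descending (act h l); [rewrite actd|move=> /andP[]].
  have Qy : desc_in [set y | nonacc y /\ lt y x] (seq.filter R y).
    have [? yR] := desc_in_filter yd; split=> // z zy; split; first exact: yR.
    by move: zy; rewrite mem_filter => /andP[_ /(allP yx)].
  have [Pky hky] := kQ _ Qy.
  have [kd kR kW] := act_descending Pky yd.
  by rewrite {1}/act kd kR kW hky -descendingE.
- rewrite /desc_lt actd dx; case: ifPn => // ld; rewrite lex_seq1 ?ltx//.
  by have : descending (act h l); [rewrite actd|move=> /andP[]].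
Qed.

(** * Well-ordering of descending lists over a well-founded set *)

Definition has_min C (r : rel C) (D : set C) :=
  exists2 x, D x & forall y, D y -> ~~ r y x.

Definition well_ordered C (r : rel C) := forall D : set C, D !=set0 -> has_min r D.

Lemma acc_has_min (D : set N) : (forall x, T x -> Acc below x) ->
  (forall x, D x -> T x) -> D !=set0 -> has_min lt D.
Proof.
move=> Tacc DT [x Dx]; have xacc := Tacc x (DT x Dx); elim: xacc Dx => {}x _ IH Dx.
have [[y Dy yx]|nex] := pselect (exists2 y, D y & lt y x).
  by apply: (IH y) => //; split=> //; exact: DT.
by exists x => // y Dy; apply/negP => yx; apply: nex; exists y.
Qed.

(** Among nonempty descending lists take the least head [a], then minimize over the tails that
    follow it. These tails have entries below [a], so accessibility induction applies. *)
Lemma desc_lt_well_ordered : (forall x, T x -> Acc below x) -> well_ordered desc_lt.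
Proof.
move=> Tacc.
pose lmin x := forall D : set (seq N), D !=set0 ->
  (forall l, D l -> descending l /\ all (lt^~ x) l) -> has_min (lex true lt) D.
have headmin (D : set (seq N)) : D !=set0 -> (forall l, D l -> descending l) ->
    (forall a l, D (a :: l) -> lmin a) -> has_min (lex true lt) D.
  move=> [l0 Dl0] Dd Dmin; have [D0|D0] := pselect (D [::]).
    by exists [::] => // l _; case: l.
  have [|||a [l Dal] amin] := @acc_has_min [set a | exists l, D (a :: l)] => //.
  - by move=> a [l /Dd]; rewrite /descending /= => /andP[/andP[]].
  - by case: l0 Dl0 => // a l Dal; exists a, l.
  have [||l' Dl' l'min] := Dmin _ _ Dal [set l' | D (a :: l')].
  - by exists l.
  - move=> l' /Dd; rewrite /descending /= => /andP[/andP[_ ->] /andP[la lp]].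
    by split.
  exists (a :: l') => // -[//|c y] Dy /=.
  rewrite negb_or amin /=; last by exists y.
  by case: eqP => //= ca; apply: l'min; rewrite /= -ca.
have Tmin x : T x -> lmin x.
  move=> Tx; have xacc := Tacc x Tx; elim: xacc Tx => {}x _ IH Tx D Dne DP; apply: headmin => //.
    by move=> l /DP[].
  move=> a l /DP[]; rewrite /descending /= => /andP[/andP[Ta _] _] /andP[ax _].
  by apply: IH; first split.
move=> D [l Dl].
have [[j Dj jd]|nj] := pselect (exists2 j, D j & ~~ descending j); last first.
  have Dd y : D y -> descending y.
    by move=> Dy; apply: contrapT => /negP yd; apply: nj; exists y.
  have [||a y Dy|x Dx xmin] := headmin D; [by exists l|by []|..].
    by apply: Tmin; have := Dd _ Dy; rewrite /descending /= => /andP[/andP[]].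
  by exists x => // y Dy; rewrite /desc_lt !Dd//= xmin.
(* Non-descending lists lie below all descending ones and are compared by [pickle], so the least
   code gives the minimum. *)
pose J n := `[< exists j, [/\ D j, ~~ descending j & pickle j = n] >].
have [|n /asboolP[i [Di id <-]] imin] := @ex_minnP J.
  by exists (pickle j); apply/asboolP; exists j.
exists i => // y Dy; rewrite /desc_lt (negbTE id); case: ifPn => //= yd.
by rewrite -leqNgt; apply: imin; apply/asboolP; exists y.
Qed.

End DescendingLists.

(** * The reduction from trees to linear orders *)

Definition has_successors C (lt : rel C) :=
  forall x, exists2 y, lt x y & forall z, lt x z -> ~~ lt z y.

Section ProdOmega.
Variables (A : eqType) (lt : rel A).
Hypothesis lst : strict_total lt.

(** Each point is replaced by a copy of omega and so acquires immediate successors. This rules out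
    limits from above, leaving the rationals as the only two-sided limits of the sum. *)
Definition omega_lt (p q : A * nat) := lt p.1 q.1 || (p.1 == q.1) && (p.2 < q.2).

Lemma omega_lt_strict_total : strict_total omega_lt.
Proof.
have [lirr ltr ltot] := lst; rewrite /omega_lt; split.
- by move=> [x n] /=; rewrite lirr ltnn andbF.
- move=> [y m] [x n] [z k] /= /orP[xy|/andP[/eqP-> nm]] /orP[yz|/andP[/eqP<- mk]].
  + by rewrite (ltr _ _ _ xy yz).
  + by rewrite xy.
  + by rewrite yz.
  + by rewrite eqxx (ltn_trans nm mk) orbT.
- move=> [x n] [y m] /=; have [->|->|->] := ltot x y; [|exact: Or32|exact: Or33].
  rewrite eqxx lirr /=; have [->|] := eqVneq n m; first exact: Or31.
  by rewrite neq_ltn => /orP[->|->]; [exact: Or32|exact: Or33].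
Qed.

Lemma omega_lt_successors : has_successors omega_lt.
Proof.
have [lirr ltr ltot] := lst.
move=> [x n]; exists (x, n.+1) => [|[y m]]; rewrite /omega_lt /=.
  by rewrite eqxx ltnSn orbT.
move=> /orP[xy|/andP[/eqP<- nm]].
  rewrite (strict_total_asym lst xy) /=; apply/negP => /andP[/eqP yx _].
  by move: xy; rewrite yx lirr.
by rewrite lirr /= eqxx /= ltnS -ltnNge.
Qed.

Lemma omega_lt_well_ordered : well_ordered lt -> well_ordered omega_lt.
Proof.
move=> lwo D [[x0 n0] Dx0].
have [|x [n Dxn] xmin] := lwo [set x | exists n, D (x, n)].
  by exists x0, n0.
pose J m := `[< D (x, m) >].
have [|m /asboolP Dxm mmin] := @ex_minnP J; first by exists n; apply/asboolP.
exists (x, m) => // -[y k] Dyk; rewrite /omega_lt /= negb_or xmin/=; last by exists k.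
case: eqP => //= yx; rewrite -leqNgt; apply: mmin; apply/asboolP.
by rewrite -yx.
Qed.

Lemma omega_lt_compresses : (exists g h b, compresses_lt lt g h b) ->
  exists g h b, compresses_lt omega_lt g h b.
Proof.
have [lirr ltr ltot] := lst.
move=> [g [h [b [gm gh gb]]]].
have ginj : injective g.
  move=> x y xy; have [//| |] := ltot x y; rewrite -gm xy lirr//.
exists (fun p => (g p.1, p.2)), (fun p => (h p.1, p.2)), (b, 0).
rewrite /omega_lt; split=> [[x n] [y m]|[x n] [y m]|[x n]] /=.
- by rewrite gm (inj_eq ginj).
- by rewrite negb_or => /andP[/gh -> _].
- by rewrite gb.
Qed.

End ProdOmega.

Section SumOrder.
Variables (A : eqType) (ltS ltT : rel A).
Hypotheses (Sst : strict_total ltS) (Tst : strict_total ltT).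

Definition sum_lt (x y : A + (rat + A)) : bool :=
  match x, y with
  | inl a, inl b => ltS b a
  | inl _, inr _ => true
  | inr _, inl _ => false
  | inr (inl p), inr (inl q) => (p < q)%R
  | inr (inl _), inr (inr _) => true
  | inr (inr _), inr (inl _) => false
  | inr (inr a), inr (inr b) => ltT a b
  end.

Lemma sum_lt_strict_total : strict_total sum_lt.
Proof.
have [Sirr Str Stot] := Sst; have [Tirr Ttr Ttot] := Tst; split.
- by move=> [a|[p|a]] //=; exact: ltxx.
- move=> [b|[q|b]] [a|[p|a]] [c|[r|c]] //=.
  + by move=> ba cb; exact: Str cb ba.
  + exact: lt_trans.
  + exact: Ttr.
- move=> [a|[p|a]] [b|[q|b]] /=; do ?[exact: Or32|exact: Or33].
  + by have [->|?|?] := Stot a b; [exact: Or31|exact: Or33|exact: Or32].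
  + by case: (ltgtP p q) => [?|?|->]; [exact: Or32|exact: Or33|exact: Or31].
  + by have [->|?|?] := Ttot a b; [exact: Or31|exact: Or32|exact: Or33].
Qed.

Lemma sum_lt_compresses : (exists g h b, compresses_lt ltT g h b) ->
  exists g h b, compresses_lt sum_lt g h b.
Proof.
move=> [g [h [b [gm gh gb]]]].
pose lift (f : A -> A) (x : A + (rat + A)) :=
  if x is inr (inr a) then inr (inr (f a)) else x.
exists (lift g), (lift h), (inr (inr b)); split.
- by move=> [a|[p|a]] [c|[q|c]] //=.
- by move=> [a|[p|a]] [c|[q|c]] //= /gh ->.
- by move=> [a|[p|a]] //=.
Qed.

(* Being a two-sided limit singles out the copy of the rationals, both in the
   whole order and in any initial segment isomorphic to it. *)
Definition limit_point C (lt : rel C) (x : C) :=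
  (forall y, lt y x -> exists z, lt y z && lt z x) /\
  (forall y, lt x y -> exists z, lt x z && lt z y).

Lemma limit_point_sum_lt x : has_successors ltS -> has_successors ltT ->
  limit_point sum_lt x <-> exists p, x = inr (inl p).
Proof.
move=> Ss Ts; split=> [[xl xr]|[p ->]].
  case: x xl xr => [a|[p|a]] xl xr; [|by exists p|].
  - have [b ab amin] := Ss a; case: (xl (inl b) ab) => -[c|[q|c]] //= /andP[cb ac].
    by have := amin c ac; rewrite cb.
  - have [b ab amin] := Ts a; case: (xr (inr (inr b)) ab) => -[d|[q|c]] //= /andP[ac cb].
    by have := amin c ac; rewrite cb.
split=> -[a|[q|a]] //= pq.
- by exists (inr (inl (p - 1)%R)) => /=; rewrite ltrBlDr ltrDl.
- by exists (inr (inl ((q + p) / 2%:R)%R)) => /=; rewrite !midf_lt.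
- by exists (inr (inl ((p + q) / 2%:R)%R)) => /=; rewrite !midf_lt.
- by exists (inr (inl (p + 1)%R)) => /=; rewrite ltrDl.
Qed.

Lemma limit_point_compresses C (lt : rel C) g h b x : strict_total lt ->
  (forall y, exists z, lt y z) ->
  compresses_lt lt g h b -> limit_point lt (g x) <-> limit_point lt x.
Proof.
move=> lst nomax [gm gh gb]; have [lirr ltr ltot] := lst.
have gh' y z : lt y (g z) -> g (h y) = y.
  by move=> yz; apply: (gh z); rewrite (strict_total_asym lst).
split=> -[xl xr]; split=> y xy.
- have [|z /andP[yz zx]] := xl (g y); first by rewrite gm.
  by exists (h z); rewrite -gm -(gm _ x) (gh' _ _ zx) yz.
- have [|z /andP[xz zy]] := xr (g y); first by rewrite gm.
  by exists (h z); rewrite -gm -(gm _ y) (gh' _ _ zy) xz.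
- have [|z] := xl (h y); first by rewrite -gm (gh' _ _ xy).
  by rewrite -gm -(gm z) (gh' _ _ xy) => yzx; exists (g z).
(* Here [y] may lie outside the range of [g]. In that case [g y'], for any [y'] above [x], already
   separates [g x] from [y]. *)
- have [y' xy'] := nomax x.
  have [gy|gy] := boolP (lt (g y') y); first by exists (g y'); rewrite gm xy'.
  have yE := gh _ _ gy; have [|z] := xr (h y); first by rewrite -gm yE.
  by rewrite -gm -(gm z) yE => xzy; exists (g z).
Qed.

Lemma sum_lt_not_compresses g h b :
  has_successors ltS -> has_successors ltT -> A -> well_ordered ltT ->
  ~ compresses_lt sum_lt g h b.
Proof.
move=> Ss Ts a0 Two cgh; have [gm gh gb] := cgh.
have nomax x : exists y, sum_lt x y.
  case: x => [a|[p|a]]; [by exists (inr (inl 0%R))|by exists (inr (inr a0))|].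
  by have [c ac _] := Ts a; exists (inr (inr c)).
have lg x := limit_point_compresses x sum_lt_strict_total nomax cgh.
(* The rational 0 is sent to a rational, so points of the last summand go above that rational; they
   cannot become rationals themselves, not being limit points. *)
have /choice[f fP] a : exists c, g (inr (inr a)) = inr (inr c).
  have /lg/(limit_point_sum_lt _ Ss Ts)[q gq] : limit_point sum_lt (inr (inl 0%R)).
    by apply/(limit_point_sum_lt _ Ss Ts); exists 0%R.
  have := gm (inr (inl 0%R)) (inr (inr a)); rewrite gq.
  case ga: (g (inr (inr a))) => [c|[p|c]] //= _; last by exists c.
  have : limit_point sum_lt (g (inr (inr a))).
    by apply/(limit_point_sum_lt _ Ss Ts); exists p.
  by move=> /lg/(limit_point_sum_lt _ Ss Ts)[].
have fm a c : ltT (f a) (f c) = ltT a c.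
  by have := gm (inr (inr a)) (inr (inr c)); rewrite !fP.
(* If [a] were least with [f a] below [a], then [f a] would be a smaller such point. *)
have fge a : ~~ ltT (f a) a.
  apply/negP => fa; have [|c fc cmin] := Two [set a | ltT (f a) a].
    by exists a.
  by have := cmin (f c); rewrite /= fm fc => /(_ isT).
have fb a : sum_lt (inr (inr (f a))) b by rewrite -fP.
(* Lying above [f a0], the bound [b] is some [c] of the last summand, and then [f c] is not below
   it. *)
case: b gb fb {cgh} => [c|[p|c]] gb fb; have := fb a0; rewrite //= => _.
by have := fb c; rewrite /= (negbTE (fge c)).
Qed.

End SumOrder.

(** * Branches and non-accessible nodes of a tree *)

Section KleeneBrouwer.
Variable T : pred (seq nat).

(* The Kleene-Brouwer order: a proper extension precedes its prefixes. *)
Local Notation kb := (lex false ltn).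

Lemma ltn_strict_total : strict_total ltn.
Proof.
split=> [x|y x z|x y] /=; [by rewrite ltnn|exact: ltn_trans|].
by case: (ltngtP x y) => [?|?|->]; [exact: Or32|exact: Or33|exact: Or31].
Qed.

Lemma kb_strict_total : strict_total kb.
Proof. exact: lex_strict_total ltn_strict_total. Qed.

(** The initial segments of the branch form an infinite descending sequence starting at the root. *)
Lemma nonacc_branch b : (forall n, T (mkseq b n)) -> nonacc kb T [::].
Proof.
move=> bT; split; first exact: (bT 0).
suff nacc s : Acc (below kb T) s -> forall n, s = mkseq b n -> False.
  by move=> /nacc/(_ 0); apply.
elim=> {}s _ IH n sn; apply: (IH (mkseq b n.+1)) => //; split=> //.
  by rewrite sn.
rewrite sn mkseqS -cats1 -[X in lex _ _ _ X]cats0 lex_catl//.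
exact: ltn_strict_total.
Qed.

(* The branch is built leftmost, through nodes whose non-accessible extensions
   form a nonempty set without KB-minimum. *)
Lemma branch_nonacc x : (forall s i, T (rcons s i) -> T s) -> nonacc kb T x ->
  exists b, forall n, T (mkseq b n).
Proof.
move=> Tpre Rx; pose R := nonacc kb T.
pose Q s := (exists t, R (s ++ t)) /\
  forall t, R (s ++ t) -> exists2 t', R (s ++ t') & kb t' t.
have Qstep s : exists i, Q s -> Q (rcons s i).
  have [Qs|nQs] := pselect (Q s); last by exists 0.
  have [[t0 Rt0] Qd] := Qs.
  pose J i := `[< exists t, R (s ++ i :: t) >].
  have Jex : exists i, J i.
    case: t0 Rt0 => [/Qd[[|i t] Rt]//|i t Rt]; exists i; apply/asboolP; by exists t.
  have [i /asboolP[t Rt] imin] := ex_minnP Jex.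
  exists i => _; split; first by exists t; rewrite cat_rcons.
  (* A smaller extension cannot end at [s], which follows its extensions, nor continue with [j < i]
     by minimality of [i]; so it passes through [rcons s i]. *)
  move=> t1; rewrite cat_rcons => /Qd[[|j t2] Rt2] //= /orP[ji|/andP[/eqP ji t21]].
    have /imin : J j by apply/asboolP; exists t2.
    by rewrite leqNgt ji.
  by exists t2; rewrite // cat_rcons -ji.
have [F FP] := choice Qstep.
pose fix st n := if n is k.+1 then rcons (st k) (F (st k)) else [::].
have stE n : st n = mkseq (fun k => F (st k)) n by elim: n => //= n IH; rewrite mkseqS -IH.
have Qst n : Q (st n).
  elim: n => [|n IH] /=; last exact: FP.
  split; first by exists x.
  move=> t /nonacc_down[y Ry yt]; by exists y.
exists (fun k => F (st k)) => n; rewrite -stE.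
have [[t [+ _]] _] := Qst n.
elim/last_ind: t => [|t i IH]; rewrite ?cats0// -rcons_cat => /Tpre.
exact: IH.
Qed.

End KleeneBrouwer.

(** * Trees for analytic sets *)

Lemma separable_sequence (X : topologicalType) (x0 : X) : separable X ->
  exists d : nat -> X, forall (x : X) (U : set X), nbhs x U -> exists n, U (d n).
Proof.
move=> [D /countable_injP[f finj] Ddense].
exists (fun n => xget x0 [set x | D x /\ f x = n]) => x U.
rewrite nbhsE => -[V [Vo Vx] VU].
have [y [Vy Dy]] : V `&` D !=set0 by apply: Ddense => //; exists x.
exists (f y); case: xgetP => [z _ [Dz fz]|/(_ y)[]//].
by rewrite (finj z y) ?inE//; exact: VU.
Qed.

Lemma polish_basis (R : realType) (X : topologicalType) (x0 : X) : polish_space R X ->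
  exists B : nat -> set X, forall (x : X) (U : set X), nbhs x U -> exists n, B n x /\ B n `<=` U.
Proof.
move=> [Xsep [M _ [i [j [ij ji ic jc]]]]].
have [d dP] := separable_sequence x0 Xsep.
exists (fun n => if (unpickle n : option (nat * nat)) is Some (p, k)
  then i @^-1` ball (i (d p)) (k.+1%:R^-1 : R)%R else set0) => x U xU.
have /nbhs_ballP[e /= e0 eU] : nbhs (i x) (j @^-1` U).
  by apply: jc; rewrite ij.
pose k := Num.truncn (e / 2%:R)^-1%R.
have ke : (k.+1%:R^-1 < e / 2%:R)%R.
  rewrite invf_plt ?posrE ?ltr0n// ?divr_gt0// ?ltr0n//.
  by rewrite truncnS_gt.
have k0 : (0 < k.+1%:R^-1 :> R)%R by rewrite invr_gt0 ltr0n.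
have [p px] : exists p, (i @^-1` ball (i x) (k.+1%:R^-1 : R)%R) (d p).
  by apply: (dP x); apply: ic; exact: nbhsx_ballx.
exists (pickle (p, k)); rewrite pickleK; split; first exact: ball_sym.
move=> z pz; rewrite -(ij z); apply: eU.
by apply: ball_split; [apply: le_ball px|apply: le_ball pz]; exact: ltW.
Qed.

(** For each pair of sets of a countable basis, choose a clopen set containing the first and missing
    the second, when there is one. *)
Lemma clopen_separating_sequence (R : realType) (X : topologicalType) :
  polish_space R X -> has_clopen_basis X ->
  exists C : nat -> set X, (forall n, clopen (C n)) /\
    forall x y, x <> y -> exists n, C n x /\ ~ C n y.
Proof.
move=> Xp [_ Xb]; have [[x0 _]|noX] := pselect (exists x : X, True); last first.
  exists (fun=> set0); split=> [_|x]; first exact: clopen0.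
  by case: noX; exists x.
have [B BP] := polish_basis x0 Xp.
pose sel p q := [set U : set X | [/\ clopen U, B p `<=` U & B q `<=` ~` U]].
exists (fun n => if (unpickle n : option (nat * nat)) is Some (p, q)
  then xget set0 (sel p q) else set0); split=> [n|x y xy].
  case: (unpickle n) => [[p q]|]; last exact: clopen0.
  by case: xgetP => [U _ []//|_]; exact: clopen0.
have [_ [M _ [i [j [ij ji ic _]]]]] := Xp.
have [V Vx Vy] : exists2 V, nbhs x V & ~ V y.
  exists (i @^-1` ball (i x) (mdist (i x) (i y))).
    apply: ic; apply: nbhsx_ballx; rewrite mdist_gt0; apply/eqP => /(can_inj ij).
    exact: xy.
  by rewrite /= ballEmdist /= ltxx.
have [U [Uclo Ux] UV] := Xb x _ Vx.
have nUy : ~ U y by move=> /UV.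
have [p [px pU]] : exists p, B p x /\ B p `<=` U.
  by apply: BP; apply: open_nbhs_nbhs; split=> //; case: Uclo.
have [q [qy qU]] : exists q, B q y /\ B q `<=` ~` U.
  by apply: BP; apply: open_nbhs_nbhs; split=> //; apply: closed_openC; case: Uclo.
exists (pickle (p, q)); rewrite pickleK.
case: xgetP => [W _ [_ pW qW]|/(_ U)]; last by case.
by split; [exact: pW|exact: qW].
Qed.

Lemma clopen_near (X : topologicalType) (C : nat -> set X) (x : X) n :
  (forall n, clopen (C n)) ->
  \forall x' \near x, forall m, m < n -> (C m x' <-> C m x).
Proof.
move=> Cclo; elim: n => [|n IH]; first exact: nearW.
have [Co Cc] := Cclo n.
have Cn : \forall x' \near x, (C n x' <-> C n x).
  have [Cx|Cx] := pselect (C n x).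
    by apply: filterS (open_nbhs_nbhs (conj Co Cx)) => x' ?; split.
  by apply: filterS (open_nbhs_nbhs (conj (closed_openC Cc) Cx)) => x' ?; split.
apply: filterS2 Cn IH => x' Cn IH m; rewrite ltnS leq_eqVlt => /orP[/eqP->//|].
exact: IH.
Qed.

(** A node [s] lists centers of shrinking balls of [Y] that share a point [y] whose image agrees
    with [x] on the first [size s] separating clopen sets. Only these finitely many sets see [x],
    whence local constancy; a branch converges to a preimage of [x]. *)
Lemma analytic_tree (R : realType) (X : topologicalType) (B : set X) :
  polish_space R X -> has_clopen_basis X -> Sigma11 R B ->
  exists T : X -> pred (seq nat),
    [/\ forall s x, \forall x' \near x, T x' s = T x s,
        forall x s i, T x (rcons s i) -> T x s &
        forall x, B x <-> exists b, forall n, T x (mkseq b n)].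
Proof.
move=> Xp Xb [Y [f [Yp fc BE]]].
have [[y0 _]|noY] := pselect (exists y : Y, True); last first.
  exists (fun _ _ => false); split=> // [s x|x]; first exact: nearW.
  split=> [|[b /(_ 0)//]]; rewrite BE => -[y].
  by case: noY; exists y.
have [C [Cclo Csep]] := clopen_separating_sequence Xp Xb.
have [Ysep [M Mc [a [c [ac ca acont ccont]]]]] := Yp.
have [d dP] := separable_sequence y0 Ysep.
pose del m : R := (m.+1%:R^-1)%R.
have del0 m : (0 < del m)%R by rewrite invr_gt0 ltr0n.
pose node x s := exists y, forall m, m < size s ->
  ball (a (d (nth 0 s m))) (del m) (a y) /\ (C m x <-> C m (f y)).
exists (fun x s => `[< node x s >]); split=> [s x|x s i|x].
- apply: filterS (clopen_near x (size s) Cclo) => x' xx'.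
  apply: asbool_equiv_eq; split=> -[y yP]; exists y => m ms;
    by have [? ?] := yP m ms; have := xx' m ms; tauto.
- move=> /asboolP[y yP]; apply/asboolP; exists y => m ms.
  have := yP m; rewrite size_rcons nth_rcons ms; apply.
  exact: ltnW.
rewrite BE; split=> [[y _ <-]|[b bP]].
  have /choice[b bP] m : exists p, ball (a y) (del m) (a (d p)).
    by apply: (dP y (a @^-1` ball (a y) (del m))); apply: acont; exact: nbhsx_ballx.
  exists b => n; apply/asboolP; exists y => m; rewrite size_mkseq => mn.
  by rewrite nth_mkseq//; split=> //; exact: ball_sym.
have /choice[y yP] n : exists y, forall m, m < n ->
    ball (a (d (b m))) (del m) (a y) /\ (C m x <-> C m (f y)).
  have /asboolP[y yP] := bP n; exists y => m mn.
  by have := yP m; rewrite size_mkseq nth_mkseq//; exact.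
(* All [a (y n)] with [n > m] lie in the ball of radius [del m] around [a (d (b m))]. *)
have [z zP] : exists z : M, a (y n) @[n --> \oo] --> z.
  apply: Mc; apply/cauchy_exP => e e0.
  have [m me] : exists m, (del m < e)%R.
    exists (Num.truncn e^-1)%R; rewrite /del invf_plt ?posrE ?ltr0n//.
    by rewrite truncnS_gt.
  exists (a (d (b m))); exists m.+1 => // n /= mn.
  by apply: le_ball (ltW me) _ _; have [] := yP n m mn.
(* Otherwise some [C j] contains [x] but not the image of the limit; as [C j] is closed, the images
   of late [y n] avoid it too, although they agree with [x] on [C j] once [n > j]. *)
exists (c z) => //; apply: contrapT => /nesym/Csep[j [Cx nCz]].
have : nbhs z ((f \o c) @^-1` (~` C j)).
  apply: continuous_comp; [exact: ccont|exact: fc|].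
  by apply: open_nbhs_nbhs; split=> //; apply: closed_openC; have [] := Cclo j.
move=> /zP near_z.
have near_y : \forall n \near \oo, ~ C j (f (c (a (y n)))) by exact: near_z.
have [n []] := filter_ex (filterI near_y (nbhs_infty_gt j)).
rewrite ac => nC jn; apply: nC.
by have [_ [+ _]] := yP n j jn; exact.
Qed.

(** * Completeness *)

Lemma compresses_lt_transport C C' (lt : rel C) (lt' : rel C') (e : C -> C') d :
  cancel e d -> cancel d e -> (forall x y, lt' (e x) (e y) = lt x y) ->
  (exists g h b, compresses_lt lt g h b) -> exists g h b, compresses_lt lt' g h b.
Proof.
move=> ed de elt [g [h [b [gm gh gb]]]].
exists (e \o g \o d), (e \o h \o d), (e b); split=> [x y|x y|x] /=.
- by rewrite elt gm -elt !de.
- by rewrite -{1}(de y) elt => /gh; rewrite ed => ->; rewrite de.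
- by rewrite elt.
Qed.

(** The underlying set is the same for all trees, so a single bijection with the naturals serves
    every code. *)
Definition carrier : countType :=
  ((seq (seq nat) * nat) + (rat + (seq (seq nat) * nat)))%type.

Section TreeOrder.
Variables S T : pred (seq nat).

Definition half_lt (T : pred (seq nat)) := omega_lt (desc_lt (lex false ltn) T).

Definition tree_lt : rel carrier := sum_lt (half_lt S) (half_lt T).

Lemma half_lt_strict_total T' : strict_total (half_lt T').
Proof. exact/omega_lt_strict_total/desc_lt_strict_total/kb_strict_total. Qed.

Lemma half_lt_successors T' : has_successors (half_lt T').
Proof. exact/omega_lt_successors/desc_lt_strict_total/kb_strict_total. Qed.

Lemma tree_lt_strict_total : strict_total tree_lt.
Proof. by apply: sum_lt_strict_total; exact: half_lt_strict_total. Qed.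

Lemma tree_lt_compresses : (forall s i, T (rcons s i) -> T s) ->
  (exists g h b, compresses_lt tree_lt g h b) <->
  exists b, forall n, T (mkseq b n).
Proof.
move=> Tpre; split=> [[g [h [b cghb]]]|[b bT]]; last first.
  apply/sum_lt_compresses/omega_lt_compresses.
    exact/desc_lt_strict_total/kb_strict_total.
  apply: desc_lt_compresses; first exact: kb_strict_total.
  by exists [::]; exact: nonacc_branch bT.
apply: contrapT => nobranch; move: cghb; apply: sum_lt_not_compresses.
- exact: half_lt_strict_total.
- exact: half_lt_strict_total.
- exact: half_lt_successors.
- exact: half_lt_successors.
- exact: ([::], 0).
- apply: omega_lt_well_ordered; apply: desc_lt_well_ordered.
  move=> x Tx; apply: contrapT => xacc; apply: nobranch.
  exact: (branch_nonacc (x := x) Tpre).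
Qed.

End TreeOrder.

Definition carrier_rev (x : carrier) : carrier :=
  match x with
  | inl a => inr (inr a)
  | inr (inl p) => inr (inl (- p)%R)
  | inr (inr a) => inl a
  end.

Lemma carrier_revK : involutive carrier_rev.
Proof. by move=> [a|[p|a]] //=; rewrite opprK. Qed.

(** Reversal exchanges the roles of [S] and [T], which reduces left compressibility to the right
    case. *)
Lemma tree_lt_rev S T x y :
  tree_lt T S (carrier_rev x) (carrier_rev y) = tree_lt S T y x.
Proof. by case: x y => [a|[p|a]] [b|[q|b]] //=; rewrite ltrN2. Qed.

Lemma carrier_bij : exists (e : nat -> carrier) d, cancel e d /\ cancel d e.
Proof.
have : ([set: carrier] #= [set: nat])%card.
  apply: eq_card_nat; first exact: countableP.
  apply/infiniteP; have [f] : $|{injfun [set: nat] >-> [set: carrier]}|.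
    by apply/injfunPex; exists (fun n => inl ([::], n)) => // m n _ _ [].
  exact: inj_card_le f.
move=> /card_set_bijP[d [_ dinj dsurj]].
have /choice[e eP] n : exists x, d x = n by have [x _ xn] := dsurj n I; exists x.
exists e, d; split=> // x; apply: dinj; rewrite ?inE//.
Qed.

(** * Transfer of the orders to codes on the naturals *)

Section Coding.
Variables (e : nat -> carrier) (d : carrier -> nat).
Hypotheses (ed : cancel e d) (de : cancel d e).

Definition tree_code (S T : pred (seq nat)) : code :=
  fun p => ~~ tree_lt S T (e p.2) (e p.1).

Lemma tree_code_LO S T : tree_code S T \in LO.
Proof.
have st := tree_lt_strict_total S T; have [lirr ltr ltot] := st.
apply/mem_set; split=> [x|x y|y x z|x y]; rewrite /code_rel /tree_code /=.
- by rewrite lirr.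
- move=> /andP[/negP xy /negP yx]; apply: (can_inj ed).
  by have [] := ltot (e x) (e y).
- by move=> xy yz; apply/negP => /(strict_total_le_lt st yz); exact/negP.
- by rewrite -negb_and; apply/negP => /andP[yx]; rewrite (strict_total_asym st yx).
Qed.

Definition tree_LO S T : LO := exist _ (tree_code S T) (tree_code_LO S T).

Lemma tree_LO_r (S T : pred (seq nat)) : (forall s i, T (rcons s i) -> T s) ->
  LO_r (tree_LO S T) <-> exists b, forall n, T (mkseq b n).
Proof.
move=> /(tree_lt_compresses S) <-.
rewrite /LO_r /= right_compressibleP; last exact: LO_linear.
pose lt i j := tree_lt S T (e i) (e j).
transitivity (exists g h b, compresses_lt lt g h b); last first.
  split; first by apply: (compresses_lt_transport (e := e) (d := d)).
  by apply: (compresses_lt_transport (e := d) (d := e)) => // x y; rewrite /lt !de.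
split=> -[g [h [b [gm gh gb]]]]; exists g, h, b; split=> [x y|x y|x].
- exact/negb_inj/gm.
- exact: gh.
- exact/negbNE/gb.
- exact: (congr1 negb (gm y x)).
- exact: gh.
- by apply/negPn/gb.
Qed.

Lemma tree_LO_l (S T : pred (seq nat)) : (forall s i, S (rcons s i) -> S s) ->
  LO_l (tree_LO S T) <-> exists b, forall n, S (mkseq b n).
Proof.
move=> /(tree_lt_compresses T) <-.
rewrite /LO_l /= left_compressibleP; last exact: LO_linear.
pose lt i j := tree_lt S T (e j) (e i).
transitivity (exists g h b, compresses_lt lt g h b); last first.
  split.
    apply: (compresses_lt_transport (e := carrier_rev \o e) (d := d \o carrier_rev)).
    - by move=> x /=; rewrite carrier_revK ed.
    - by move=> x /=; rewrite de carrier_revK.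
    - by move=> x y; exact: tree_lt_rev.
  apply: (compresses_lt_transport (e := d \o carrier_rev) (d := carrier_rev \o e)).
  - by move=> x /=; rewrite de carrier_revK.
  - by move=> x /=; rewrite carrier_revK ed.
  - by move=> x y; rewrite /lt /= !de tree_lt_rev.
split=> -[g [h [b [gm gh gb]]]]; exists g, h, b; split=> [x y|x y|x].
- exact/negb_inj/gm.
- exact: gh.
- exact/negbNE/gb.
- exact: (congr1 negb (gm y x)).
- exact: gh.
- by apply/negPn/gb.
Qed.

(** Comparing two points consults the tree only at the finitely many nodes listed in them. *)
Lemma near_half_lt (X : topologicalType) (T : X -> pred (seq nat)) (x : X) p q :
  (forall s x, \forall x' \near x, T x' s = T x s) ->
  \forall x' \near x, half_lt (T x') p q = half_lt (T x) p q.
Proof.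
move=> Tc.
have near_desc l : \forall x' \near x,
    descending (lex false ltn) (T x') l = descending (lex false ltn) (T x) l.
  suff : \forall x' \near x, all (T x') l = all (T x) l.
    by apply: filterS => x' Tl; rewrite /descending Tl.
  elim: l => [|s l IH]; first exact: nearW.
  by apply: filterS2 (Tc s x) IH => x' /= -> ->.
apply: filterS2 (near_desc p.1) (near_desc q.1) => x' xp xq.
by rewrite /half_lt /omega_lt /desc_lt xp xq.
Qed.

Lemma continuous_tree_LO (X : topologicalType) (S T : X -> pred (seq nat)) :
  (forall s x, \forall x' \near x, S x' s = S x s) ->
  (forall s x, \forall x' \near x, T x' s = T x s) ->
  continuous (fun x => tree_LO (S x) (T x)).
Proof.
move=> Sc Tc; apply: continuous_LO => x p.
suff : \forall x' \near x, tree_lt (S x') (T x') (e p.2) (e p.1) =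
                           tree_lt (S x) (T x) (e p.2) (e p.1).
  by apply: filterS => x' xp; rewrite !set_valE /= /tree_code xp.
case: (e p.2) (e p.1) => [a|[u|a]] [b|[v|b]] /=; do ?[exact: nearW].
- exact: near_half_lt.
- exact: near_half_lt.
Qed.

End Coding.

(** One continuous map decides two arbitrary analytic sets independently; every hardness claim is an
    instance. *)
Lemma wadge_pair_LO (R : realType) (X : topologicalType) (B C : set X) :
  polish_space R X -> has_clopen_basis X -> Sigma11 R B -> Sigma11 R C ->
  exists2 phi : X -> LO, continuous phi &
    forall x, (LO_l (phi x) <-> B x) /\ (LO_r (phi x) <-> C x).
Proof.
move=> Xp Xb BS CS; have [e [d [ed de]]] := carrier_bij.
have [S [Sc Spre SB]] := analytic_tree Xp Xb BS.
have [T [Tc Tpre TC]] := analytic_tree Xp Xb CS.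
exists (fun x => tree_LO ed (S x) (T x)); first exact: continuous_tree_LO.
move=> x; split.
  exact: iff_trans (tree_LO_l ed de (T x) (Spre x)) (iff_sym (SB x)).
exact: iff_trans (tree_LO_r ed de (S x) (Tpre x)) (iff_sym (TC x)).
Qed.

Theorem theorem3p23 (R : realType) :
  [/\ class_complete R (Sigma11 R) LO_l,
      class_complete R (Sigma11 R) LO_r &
      class_complete R (Sigma11 R) (LO_r `&` LO_l)] /\
  class_complete R (Pi11 R) (~` (LO_r `|` LO_l)) /\
  class_complete R (D2Pi11 R) (LO_r `\` LO_l) /\
  class_complete R (D2Pi11 R) (LO_l `\` LO_r).
Proof.
have Sr := Sigma11_LO_r R; have Sl := Sigma11_LO_l R.
split; [split; split=> //|split; [split|split; split]].
- move=> X Xp Xb B BS; have [phi phic phiP] := wadge_pair_LO Xp Xb BS BS.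
  by exists phi => //; apply/seteqP; split=> x; have [? ?] := phiP x => /=; tauto.
- move=> X Xp Xb B BS; have [phi phic phiP] := wadge_pair_LO Xp Xb BS BS.
  by exists phi => //; apply/seteqP; split=> x; have [? ?] := phiP x => /=; tauto.
- exact: Sigma11_LO_rI.
- move=> X Xp Xb B BS; have [phi phic phiP] := wadge_pair_LO Xp Xb BS BS.
  by exists phi => //; apply/seteqP; split=> x; have [? ?] := phiP x => /=;
    rewrite /setI /=; tauto.
- by rewrite /Pi11 setCK; exact: Sigma11_LO_rU.
(* The analytic set on both sides is the complement of [B]: there the code is compressible in both
   directions, on [B] in neither. *)
- move=> X Xp Xb B BS; have [phi phic phiP] := wadge_pair_LO Xp Xb BS BS.
  exists phi => //; apply/seteqP; split=> x; have [pl pr] := phiP x => /=.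
    by move=> Bx [/pr|/pl].
  by move=> nrl; apply: contrapT => nB; apply: nrl; left; apply/pr.
- by exists LO_r, (~` LO_l); rewrite /Pi11 setCK setDE.
- move=> X Xp Xb _ [B [C [BS CS ->]]].
  (* The complement of [C] controls left compressibility and [B] right compressibility. *)
  have [phi phic phiP] := wadge_pair_LO Xp Xb CS BS.
  exists phi => //; apply/seteqP; split=> x; have [pl pr] := phiP x => /=.
    by move=> [Bx Cx]; split; [exact/pr|move=> /pl].
  by move=> [/pr Bx nl]; split=> //; apply: contrapT => nC; apply/nl/pl.
- by exists LO_l, (~` LO_r); rewrite /Pi11 setCK setDE.
- move=> X Xp Xb _ [B [C [BS CS ->]]].
  have [phi phic phiP] := wadge_pair_LO Xp Xb BS CS.
  exists phi => //; apply/seteqP; split=> x; have [pl pr] := phiP x => /=.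
    by move=> [Bx Cx]; split; [exact/pl|move=> /pr].
  by move=> [/pl Bx nr]; split=> //; apply: contrapT => nC; apply/nr/pr.
Qed.
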